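(* Fix the structure vector $\boldsymbol{\ell}=(\ell_1,\dots,\ell_{\mathcal K})$. There exist constants $K$, $C^{(1)}$, $C^{(2)}$, depending only on $\boldsymbol\ell$ (in particular neither on $N$ nor on $\eta$), such that the following holds. Let $\mathbf{x}\in\mathbb{C}^{R}$ be a data point with $|z_j|=1$ for $j=1,\dots,\mathcal K$, with $\eta=\eta(\mathbf{x})>0$, with $a_{\ell_j-1,j}\neq 0$ for $j=1,\dots,\mathcal{K}$, and with $|a_{\ell,j}|\le A$ for all $\ell,j$. Then for every $N\ge R$ the Jacobian matrix $\mathcal{J}_N(\mathbf{x})$ has full rank. Furthermore, for $N>K\cdot\eta^{-1}$ and every $j=1,\dots,\mathcal K$, $$\kappa_{L_j+\ell,N}(\mathbf{x})\le C^{(1)}A\left(1+\frac{|a_{\ell-1,j}|}{|a_{\ell_j-1,j}|}\right)\cdot\frac{1}{N^{\ell+1-\max_i \ell_i}},\qquad \ell=0,\dots,\ell_j-1,$$ $$\kappa_{L_j+\ell_j,N}(\mathbf{x})\le C^{(2)}A\,\frac{1}{|a_{\ell_j-1,j}|}\cdot\frac{1}{N^{\ell_j+1-\max_i\ell_i}}.$$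
   Context: Let $\mathcal K\ge 1$ and let $\boldsymbol{\ell}=(\ell_1,\dots,\ell_{\mathcal K})$ be a vector of positive integers (the problem structure vector). Put $R=\sum_{i=1}^{\mathcal K}\ell_i+\mathcal K$ and $L_j=1+\sum_{m=1}^{j-1}(\ell_m+1)$. A data point is a vector $\mathbf{x}=(a_{0,1},\dots,a_{\ell_1-1,1},z_1,\dots,a_{0,\mathcal K},\dots,a_{\ell_{\mathcal K}-1,\mathcal K},z_{\mathcal K})^T\in\mathbb{C}^R$, so that $a_{\ell,j}$ is the coordinate number $L_j+\ell$ and $z_j$ is the coordinate number $L_j+\ell_j$. Put $a_{-1,j}:=0$. For $N\ge R$ the forward map $\mathcal{P}_N:\mathbb{C}^R\to\mathbb{C}^N$ is $\mathcal{P}_N(\mathbf{x})=(m_0,\dots,m_{N-1})^T$, where $m_k=\sum_{j=1}^{\mathcal K}z_j^k\sum_{\ell=0}^{\ell_j-1}a_{\ell,j}k^\ell$ (with $0^0=1$). $\mathcal{J}_N(\mathbf{x})=d\mathcal{P}_N(\mathbf{x})\in\mathbb{C}^{N\times R}$ is its Jacobian matrix, and $\mathcal{J}_N^\dagger$ is the Moore-Penrose pseudo-inverse of $\mathcal J_N$. When $\mathcal{J}_N(\mathbf{x})$ has full rank, the componentwise condition number of parameter $\alpha\in\{1,\dots,R\}$ is $$\kappa_{\alpha,N}(\mathbf{x})=\sum_{i=1}^N\left|\left(\mathcal{J}_N^\dagger(\mathbf{x})\right)_{\alpha,i}\right|\,|m_{i-1}|.$$ For a data point with $|z_j|=1$ for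 all $j$, the node separation is $\eta^{(j)}=\min_{r\ne j}|\arg z_j-\arg z_r|$, angles being measured modulo $2\pi$ with the convention $\eta^{(j)}\le\pi$ (so an empty minimum is read as $\pi$), and $\eta=\eta(\mathbf{x})=\min_j\eta^{(j)}$. *)

(* Defs.v *)
From HB Require Import structures.
From mathcomp Require Import all_boot all_order all_algebra.
From mathcomp Require Import complex.
From mathcomp Require Import boolp classical_sets reals topology normedtype.
From mathcomp Require Import derive trigo.
From mathcomp Require Import ring.

Set Implicit Arguments.
Unset Strict Implicit.
Unset Printing Implicit Defensive.

Import Order.TTheory GRing.Theory Num.Theory.
Import ComplexField.Normc.
Import numFieldNormedType.Exports.

Local Open Scope ring_scope.
Local Open Scope complex_scope.
Local Open Scope sesquilinear_scope.

Section Angles.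
Variable R : realType.
Implicit Types z w : R[i].

Definition is_arg z (t : R) : Prop :=
  - pi < t <= pi /\ z = (normc z)%:C * (cos t +i* sin t).

(* The principal argument, in ]-pi, pi]; unspecified at z = 0. *)
Definition arg z : R := get (is_arg z).

Lemma argP (z : R[i]) : is_arg z (arg z).
Proof.
apply: getPex.
have pi0 := pi_gt0 R.
have [->|z0] := eqVneq z 0.
  exists pi; split; first by rewrite lexx andbT (lt_trans _ pi0) // oppr_lt0.
  by rewrite normc0 mul0r.
case: z z0 => a b z0.
rewrite /is_arg; set n := normc _.
have n2 : n ^+ 2 = a ^+ 2 + b ^+ 2 by rewrite sqr_sqrtr // addr_ge0 ?sqr_ge0.
have n0 : n != 0 by apply: contra_neq z0 => /eq0_normc.
have np : 0 < n by rewrite lt_neqAle eq_sym n0 sqrtr_ge0.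
pose u := a / n; pose v := b / n.
have uv : v ^+ 2 = 1 - u ^+ 2.
  by rewrite /u /v !expr_div_n n2; field; rewrite -n2 expf_neq0.
have u1 : -1 <= u <= 1.
  by rewrite -ler_norml -(@ler_pXn2r _ 2) ?nnegrE // real_normK ?num_real // expr1n -subr_ge0 -uv sqr_ge0.
have au : cos (acos u) = u by rewrite acosK.
have sau : sin (acos u) = `|v| by rewrite sin_acos // -uv sqrtr_sqr.
have [v0|v0] := leP 0 v.
  exists (acos u); split.
    by rewrite acos_lepi // andbT (lt_le_trans _ (acos_ge0 u1)) // oppr_lt0.
  rewrite au sau ger0_norm //; apply/eqP; rewrite eq_complex /= !mul0r subr0 addr0.
  by rewrite /u /v !mulrA ![n * _]mulrC !mulfK ?eqxx.
exists (- acos u); split.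
  rewrite ltrN2 acos_ltpi ?(le_trans _ (ltW pi0)) ?oppr_le0 ?acos_ge0 //.
  move: u1 => /andP[u1 ->]; rewrite andbT lt_neqAle u1 andbT; apply: contraTneq v0 => h.
  by move: uv; rewrite -h sqrrN expr1n subrr => /eqP; rewrite sqrf_eq0 => /eqP->; rewrite ltxx.
rewrite cosN sinN au sau ltr0_norm // opprK; apply/eqP; rewrite eq_complex /= !mul0r subr0 addr0.
by rewrite /u /v !mulrA ![n * _]mulrC !mulfK ?eqxx.
Qed.

(* |arg z - arg w| modulo 2 pi, taken in [0, pi]. *)
Definition angle_dist z w : R :=
  let d := `|arg z - arg w| in Num.min d (2 * pi - d).

End Angles.

Section PseudoInverse.
Variables (C : numClosedFieldType) (m n : nat).
Implicit Types (A : 'M[C]_(m, n)) (B : 'M[C]_(n, m)).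

Definition is_moore_penrose A B : Prop :=
  [/\ A *m B *m A = A, B *m A *m B = B,
      (A *m B)^t* = A *m B & (B *m A)^t* = B *m A].

Definition moore_penrose A : 'M[C]_(n, m) := get (is_moore_penrose A).

Definition full_rank A : Prop := \rank A = minn m n.

End PseudoInverse.

Section PseudoInverseTheory.
Variable C : numClosedFieldType.
Lemma adjM m n p (A : 'M[C]_(m, n)) (B : 'M_(n, p)) :
  (A *m B)^t* = B^t* *m A^t*.
Proof. by rewrite trmx_mul map_mxM. Qed.

Lemma adjK m n (A : 'M[C]_(m, n)) : (A^t*)^t* = A.
Proof. by apply/matrixP => i j; rewrite !mxE conjCK. Qed.

Lemma moore_penrose_unique m n (A : 'M[C]_(m, n)) B B' :
  is_moore_penrose A B -> is_moore_penrose A B' -> B = B'.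
Proof.
move=> [ABA BAB AB BA] [AB'A B'AB' AB' B'A].
have e1 : A *m B = A *m B'.
  by rewrite -AB -[in LHS]AB'A -mulmxA adjM AB AB' mulmxA ABA.
have e2 : B *m A = B' *m A.
  rewrite -BA -[A in LHS]AB'A -(mulmxA A) mulmxA adjM BA B'A.
  by rewrite -mulmxA (mulmxA A) ABA.
by rewrite -BAB e2 -mulmxA e1 mulmxA.
Qed.

Lemma gram_unit m n (A : 'M[C]_(m, n)) :
  \rank A = n -> A^t* *m A \in unitmx.
Proof.
move=> rA; rewrite -row_free_unit -kermx_eq0; apply/eqP/row_matrixP => i.
rewrite row0; set v := row i _.
have v0 : v *m (A^t* *m A) = 0 by apply: sub_kermxP; rewrite row_sub.
have w0 : v *m A^t* = 0.
  have : (v *m A^t*) *m (v *m A^t*)^t* = 0.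
    by rewrite adjM adjK !mulmxA -(mulmxA v) v0 mul0mx.
  move=> /matrixP/(_ 0 0); rewrite !mxE => /eqP.
  rewrite psumr_eq0 => [/allP h|j _]; last by rewrite !mxE mul_conjC_ge0.
  apply/rowP => j; rewrite mxE; apply/eqP.
  by have := h j (mem_index_enum _); rewrite !mxE mul_conjC_eq0.
have : row_free (A^t*) by rewrite /row_free mxrank_map mxrank_tr rA.
by move=> /row_free_inj; apply; rewrite w0 mul0mx.
Qed.

Lemma moore_penrose_ex m n r (L : 'M[C]_(m, r)) (F : 'M_(r, n)) :
  L^t* *m L \in unitmx -> F *m F^t* \in unitmx ->
  is_moore_penrose (L *m F)
    (F^t* *m invmx (F *m F^t*) *m (invmx (L^t* *m L) *m L^t*)).
Proof.
move=> GL GF.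
have hG p (G : 'M[C]_p) : G^t* = G -> (invmx G)^t* = invmx G.
  by move=> h; rewrite trmx_inv map_invmx h.
have hGL : (invmx (L^t* *m L))^t* = invmx (L^t* *m L).
  by apply: hG; rewrite adjM adjK.
have hGF : (invmx (F *m F^t*))^t* = invmx (F *m F^t*).
  by apply: hG; rewrite adjM adjK.
move: GL GF hGL hGF; set G := L^t* *m L; set H := F *m F^t* => GL GF hGL hGF.
have e1 : L *m F *m (F^t* *m invmx H *m (invmx G *m L^t*))
   = L *m (invmx G *m L^t*).
  by rewrite !mulmxA -(mulmxA L F) -/H mulmxK.
have e2 : F^t* *m invmx H *m (invmx G *m L^t*) *m (L *m F)
   = F^t* *m invmx H *m F.
  by rewrite !mulmxA -(mulmxA _ (L^t*)) -/G mulmxKV.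
split; rewrite ?e1 ?e2.
- by rewrite !mulmxA -(mulmxA _ (L^t*)) -/G mulmxKV.
- by rewrite !mulmxA -(mulmxA _ F) -/H mulmxKV.
- by rewrite !adjM hGL adjK mulmxA.
- by rewrite !adjM hGF adjK mulmxA.
Qed.
Lemma moore_penroseP m n (A : 'M[C]_(m, n)) : is_moore_penrose A (moore_penrose A).
Proof.
apply: getPex.
have GL : (col_base A)^t* *m col_base A \in unitmx by apply: gram_unit; apply/eqP; exact: col_base_full.
have GF : row_base A *m (row_base A)^t* \in unitmx.
  rewrite -{1}(adjK (row_base A)); apply: gram_unit.
  by rewrite mxrank_map mxrank_tr; apply/eqP; exact: row_base_free.
have := moore_penrose_ex GL GF; rewrite mulmx_base => h.
by eexists; exact: h.
Qed.
End PseudoInverseTheory.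

Section Prony.
Variables (R : realType) (K : nat) (l : 'I_K -> nat).

Definition nparams : nat := (\sum_(i < K) l i + K)%N.

(* The zero-based position of a_{0,j}, i.e. L_j - 1. *)
Definition offset (j : 'I_K) : nat := (\sum_(m < K | m < j) (l m).+1)%N.

Lemma offset_lt (j : 'I_K) (k : 'I_(l j).+1) : (offset j + k < nparams)%N.
Proof.
have -> : nparams = (\sum_(i < K) (l i).+1)%N.
  rewrite /nparams -[X in (_ + X)%N]card_ord -sum1_card -big_split /=.
  by apply: eq_bigr => i _; rewrite addn1.
rewrite (bigID (fun m : 'I_K => (m < j)%N)) /= ltn_add2l.
rewrite (bigD1 j) ?ltnn //=.
by rewrite (leq_trans (ltn_ord k)) // leq_addr.
Qed.

(* The zero-based coordinate number L_j + k - 1, meaningful for k <= l_j. *)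
Definition param (j : 'I_K) (k : nat) : 'I_nparams :=
  Ordinal (offset_lt (inord k : 'I_(l j).+1)).

(* Elements of C^R and of C^N are represented by row vectors. *)
Implicit Type x : 'rV[R[i]]_nparams.

Definition coef x (j : 'I_K) (k : nat) : R[i] := x 0 (param j k).
Definition node x (j : 'I_K) : R[i] := x 0 (param j (l j)).

(* a_{k-1,j}, with a_{-1,j} = 0. *)
Definition coef_pred x (j : 'I_K) (k : nat) : R[i] :=
  if k is k'.+1 then coef x j k' else 0.

Definition moment x (k : nat) : R[i] :=
  \sum_(j < K) node x j ^+ k * \sum_(i < l j) coef x j i * k%:R ^+ i.

Definition forward_map (N : nat) x : 'rV[R[i]]_N := \row_(k < N) moment x k.

(* MathComp-Analysis' [jacobian] acts on row vectors, whence the transpose. *)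
Definition jacobian_mx (N : nat) x : 'M[R[i]]_(N, nparams) :=
  (jacobian (forward_map N) x)^T.

Definition cond_num (N : nat) x (alpha : 'I_nparams) : R :=
  \sum_(i < N)
    normc (moore_penrose (jacobian_mx N x) alpha i) * normc (moment x i).

(* Angular distances are at most pi, so the index pi of the minimum only
   matters for an empty range. *)
Definition node_separation x (j : 'I_K) : R :=
  \big[Num.min/pi]_(r < K | r != j) angle_dist (node x j) (node x r).

Definition min_separation x : R :=
  \big[Num.min/pi]_(j < K) node_separation x j.

End Prony.

(* Main.v *)
Require Import Defs.
From HB Require Import structures.
From mathcomp Require Import all_boot all_order all_algebra.
From mathcomp Require Import complex reals.
From mathcomp Require Import boolp functions topology normedtype derive trigo.
From mathcomp Require Import ring lra zify.

(** The Jacobian matrix J is a confluent Vandermonde matrix (entries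
    z_r^k k^i, for i <= l_r) up to an invertible change of columns: its column
    for a_{i,r} is z_r^k k^i, and its column for z_r is z_r^-1 times the
    combination of the z_r^k k^(i+1) with coefficients a_{i,r}.  If w is any row
    vector with w J = e_alpha, then J has a left inverse as soon as such a w
    exists for each alpha, and row alpha of the pseudo-inverse is the orthogonal
    projection of w, hence no longer than w in l^2 norm.  By Cauchy-Schwarz its
    l^1 norm is at most N max_k |w_k| ([moore_penrose_row_l1]).  So everything
    reduces to exhibiting, for each alpha, one w with small entries.

    Read w as the coefficients of a polynomial W of degree < N, and let D be the
    Euler operator X d/dX, which multiplies the k-th coefficient by k.  Pairing w
    with the column z_r^k k^i gives (D^i W)(z_r).  Hence it suffices to find
    Hermite dual polynomials W_{j,m}, with (D^i W_{j,m})(z_r) = 1 if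
    (r, i) = (j, m) and 0 for the other i <= l_r, whose coefficients are
    O(N^-(m+1)) with a constant depending on l only.  The change of columns then
    gives w = W_{j,m} - (a_{m-1,j} / a_{l_j-1,j}) W_{j,l_j} for the parameter
    a_{m,j}, and w = (z_j / a_{l_j-1,j}) W_{j,l_j} for z_j, which is where the two
    different factors of the bounds come from ([coef_dual_row],
    [node_dual_row]).

    The dual polynomials are explicit ([hermite_dual_poly]).
    - To vanish at z_r without large coefficients, use
      (X^q - z_r^q) / (z_j^q - z_r^q), raised to the power l_r + 1, where q is
      chosen so that q times the angle between z_j and z_r lies in [pi/2, pi]:
      the denominator is then at least 1 in modulus, multiplication by the
      factor at most doubles the largest coefficient, and its degree q is at most
      pi / eta ([power_separates]).  Under the hypothesis N > 2 pi P / eta, where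
      P = [nparams l], all these factors together use at most half of the
      available degree.
    - To prescribe the jet at z_j, multiply by the average of (X/z_j)^k over
      k < s, whose coefficients are 1/s, and by a power m of (X/z_j)^s - 1,
      which vanishes at z_j to order m with (D^m)-value m! s^m.  Here s is a fixed
      fraction of N, so dividing by m! s^m gives coefficients O(N^-(m+1)).
    - The values of D^i at z_j for i > m are then removed one after the other,
      using the same polynomials for larger m; as D costs a factor N and the
      polynomials for i are smaller by N^(m-i), each step preserves the order of
      magnitude of the coefficients ([hermite_correction]).

    Full rank for every N >= P follows from the same construction with all the
    exponents q and s equal to 1, whose total degree is below P; the size of the
    coefficients does not matter there.

    Finally |m_k| is at most P A N^(max l - 1), and the condition number is at most
    this bound times the l^1 norm of the row ([cond_num_le]). *)

Set Implicit Arguments.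
Unset Strict Implicit.
Unset Printing Implicit Defensive.

Import Order.TTheory GRing.Theory Num.Theory.
Import ComplexField.Normc.
Import numFieldNormedType.Exports.
Local Open Scope ring_scope.

(** * The modulus of complex numbers *)

Section ComplexModulus.
Context {R : rcfType}.
Implicit Types z w : R[i].

Lemma normc_ge0 z : 0 <= normc z.
Proof. by case: z => a b; exact: sqrtr_ge0. Qed.

Lemma normc_eq0 z : (normc z == 0) = (z == 0).
Proof. by apply/eqP/eqP => [/eq0_normc //|->]; rewrite normc0. Qed.

Lemma normcX z n : normc (z ^+ n) = normc z ^+ n.
Proof. by elim: n => [|n IH]; rewrite ?expr0 ?normc1 // !exprS normcM IH. Qed.

Lemma normc_nat n : normc (n%:R : R[i]) = n%:R.
Proof. by rewrite -[n%:R in LHS]mulr_natr mul1r normcMn normc1. Qed.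

Lemma normc_sum (I : Type) (s : seq I) (P : pred I) (f : I -> R[i]) :
  normc (\sum_(i <- s | P i) f i) <= \sum_(i <- s | P i) normc (f i).
Proof.
elim/big_ind2: _ => [|x a y b xa yb|//]; first by rewrite normc0.
exact: le_trans (le_normcD _ _) (lerD xa yb).
Qed.
End ComplexModulus.

(** * The Jacobian matrix of the forward map *)

Section Differentials.
Context {F : numFieldType} {V W : normedModType F}.

Lemma is_diff_sum (I : Type) (s : seq I) (P : pred I) (f df : I -> V -> W) x :
  (forall i, is_diff x (f i) (df i)) ->
  is_diff x (fun y => \sum_(i <- s | P i) f i y)
            (fun v => \sum_(i <- s | P i) df i v).
Proof.
move=> fdf.
have -> : (fun y => \sum_(i <- s | P i) f i y) = \sum_(i <- s | P i) f i.
  by apply: funext => y; rewrite fct_sumE.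
have -> : (fun y => \sum_(i <- s | P i) df i y) = \sum_(i <- s | P i) df i.
  by apply: funext => y; rewrite fct_sumE.
elim: s => [|i s IH]; first by rewrite !big_nil; exact: is_diff_cst.
by rewrite !big_cons; case: ifP => // _; exact: is_diffD.
Qed.

Lemma is_diff_coord m n (M : 'M[F]_(m, n)) i j :
  is_diff M (fun N : 'M[F]_(m, n) => N i j : F) (fun N => N i j).
Proof.
have cf : continuous (fun N : 'M[F]_(m, n) => N i j) by exact: coord_continuous.
have lf : linear (fun N : 'M[F]_(m, n) => N i j) by move=> a u v; rewrite !mxE.
pose fM := GRing.isLinear.Build _ _ _ _ _ lf.
pose f : {linear 'M[F]_(m, n) -> F} := HB.pack (fun N : 'M[F]_(m, n) => N i j) fM.
by apply: DiffDef; [exact: (@linear_differentiable _ _ _ f)|exact: (@diff_lin _ _ _ f)].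
Qed.

Lemma is_diff_scalel_fun (k dk : V -> F) (w : W) x :
  is_diff x k dk -> is_diff x (fun y => k y *: w) (fun v => dk v *: w).
Proof.
move=> kdk; apply: DiffDef; first exact: differentiableZl.
by rewrite diffZl // diff_val.
Qed.
End Differentials.

Lemma is_diff_row {F : numFieldType} {V : normedModType F}
    n (f df : 'I_n -> V -> F) x :
  (forall i, is_diff x (f i) (df i)) ->
  is_diff x (fun y => \row_(i < n) f i y) (fun v => \row_(i < n) df i v).
Proof.
move=> fdf.
have rowE (g : 'I_n -> V -> F) : (fun y => \row_(i < n) g i y)
    = (fun y => \sum_(i < n) g i y *: (delta_mx 0 i : 'rV[F]_n)).
  apply: funext => y; apply/rowP => k; rewrite mxE summxE (bigD1 k) //= big1.
    by rewrite !mxE !eqxx mulr1 addr0.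
  by move=> i ik; rewrite !mxE eqxx eq_sym (negbTE ik) mulr0.
by rewrite !rowE; apply: is_diff_sum => i; exact: is_diff_scalel_fun.
Qed.

Section ExponentialSum.
Context {F : numFieldType} {n K N : nat} (l : 'I_K -> nat).
(* Positions of the nodes and of the coefficients among the coordinates. *)
Variables (pz : 'I_K -> 'I_n) (pa : 'I_K -> nat -> 'I_n).
Implicit Types x v : 'rV[F]_n.

Definition expsum x (k : nat) : F :=
  \sum_(j < K) x 0 (pz j) ^+ k * \sum_(i < l j) x 0 (pa j i) * k%:R ^+ i.

Definition dexpsum x (k : nat) v : F :=
  \sum_(j < K)
    (x 0 (pz j) ^+ k * (\sum_(i < l j) v 0 (pa j i) * k%:R ^+ i)
     + (\sum_(i < l j) x 0 (pa j i) * k%:R ^+ i)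
       * (k%:R * x 0 (pz j) ^+ k.-1 * v 0 (pz j))).

Lemma is_diff_expsum k x : is_diff x (expsum ^~ k) (dexpsum x k).
Proof.
apply: is_diff_sum => j.
have dn : is_diff x (fun y : 'rV[F]_n => y 0 (pz j)) (fun v => v 0 (pz j)).
  exact: is_diff_coord.
have dc : is_diff x (fun y : 'rV[F]_n => \sum_(i < l j) y 0 (pa j i) * k%:R ^+ i)
                    (fun v => \sum_(i < l j) v 0 (pa j i) * k%:R ^+ i).
  apply: is_diff_sum => i.
  exact: (is_diff_scalel_fun (k%:R ^+ i : F) (is_diff_coord x 0 (pa j i))).
have dnk : is_diff x (fun y : 'rV[F]_n => y 0 (pz j) ^+ k)
    (fun v => k%:R * x 0 (pz j) ^+ k.-1 * v 0 (pz j)).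
  case: k {dc} => [|k]; last by have := is_diffX k dn; rewrite exprfctE.
  rewrite (_ : (fun v : 'rV[F]_n => 0 * _ * _) = 0); first exact: is_diff_cst.
  by apply: funext => v; rewrite !mul0r.
exact: (is_diffM dnk dc).
Qed.

Lemma jacobian_expsum x (a : 'I_n) (k : 'I_N) :
  jacobian (fun y => \row_(k < N) expsum y k) x a k = dexpsum x k (delta_mx 0 a).
Proof.
have h := is_diff_row (fun k : 'I_N => is_diff_expsum k x).
by rewrite /jacobian mxE diff_val mxE.
Qed.
End ExponentialSum.

Section Jacobian.
Context {R : realType} {K : nat} (l : 'I_K -> nat).
Implicit Type x : 'rV[R[i]]_(nparams l).

Lemma jacobian_mxE N x (k : 'I_N) a :
  jacobian_mx N x k a =
  \sum_(j < K)
    (node x j ^+ k * (\sum_(i < l j) (param l j i == a)%:R * k%:R ^+ i)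
     + (\sum_(i < l j) coef x j i * k%:R ^+ i)
       * (k%:R * node x j ^+ k.-1 * (param l j (l j) == a)%:R)).
Proof.
rewrite /jacobian_mx mxE.
have h := jacobian_expsum l (fun j => param l j (l j)) (param l) x a k.
apply: (etrans h); apply: eq_bigr => j _.
rewrite mxE eqxx /=; congr (_ * _ + _).
by apply: eq_bigr => i _; rewrite mxE eqxx.
Qed.
End Jacobian.

Lemma nparamsE K (l : 'I_K -> nat) : nparams l = (\sum_(i < K) (l i).+1)%N.
Proof.
rewrite /nparams -[X in (_ + X)%N]card_ord -sum1_card -big_split /=.
by apply: eq_bigr => i _; rewrite addn1.
Qed.

Section ParameterIndices.
Context {R : realType} {K : nat} (l : 'I_K -> nat).
Implicit Types x : 'rV[R[i]]_(nparams l).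

Lemma val_param j k : (k <= l j)%N -> param l j k = (offset l j + k)%N :> nat.
Proof. by move=> kl; rewrite /= inordK. Qed.

Lemma leq_offset (j j' : 'I_K) : (j < j')%N ->
  (offset l j + (l j).+1 <= offset l j')%N.
Proof.
move=> jj'; rewrite /offset [leqRHS](bigD1 j) //= addnC leq_add2l.
rewrite [leqLHS]big_mkcond [leqRHS]big_mkcond /=; apply: leq_sum => m _.
case: ltnP => // mj; rewrite (ltn_trans mj jj') /=.
by case: eqVneq mj => [->|//]; rewrite ltnn.
Qed.

Lemma eq_param j j' k k' : (k <= l j)%N -> (k' <= l j')%N ->
  (param l j k == param l j' k') = (j == j') && (k == k').
Proof.
move=> kl kl'; rewrite -val_eqE [val _]val_param // [val (param _ _ k')]val_param //.
have [<-|jj'] /= := eqVneq j j'; first by rewrite eqn_add2l.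
have : (j < j')%N \/ (j' < j)%N by move: jj'; rewrite -val_eqE /=; lia.
by case=> /leq_offset h; apply/negbTE/negP => /eqP; lia.
Qed.

(** The positions [param l j k] with [k <= l j] are pairwise distinct, and there
    are [\sum_j (l j).+1 = nparams l] of them. *)
Lemma param_surj (a : 'I_(nparams l)) : exists j k, (k <= l j)%N /\ a = param l j k.
Proof.
pose f (u : {j : 'I_K & 'I_(l j).+1}) := param l (tag u) (tagged u).
have finj : injective f.
  move=> [j k] [j' k']; rewrite /f /= => /eqP.
  rewrite eq_param ?leq_ord // => /andP[/eqP jj']; case: _ / jj' k' => k'.
  by move=> /eqP/val_inj ->.
have fcard : (#|'I_(nparams l)| <= #|{: {j : 'I_K & 'I_(l j).+1}}|)%N.
  rewrite card_ord card_tagged nparamsE sumnE big_map big_enum /=.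
  by apply: leq_sum => i _; rewrite card_ord.
have /codomP[[j k] ->] : a \in codom f by exact: inj_card_onto finj fcard a.
by exists j, k; split => //; rewrite leq_ord.
Qed.

Lemma jacobian_mx_coef N x (k : 'I_N) r i : (i < l r)%N ->
  jacobian_mx N x k (param l r i) = node x r ^+ k * k%:R ^+ i.
Proof.
move=> ilr; have coefE j : \sum_(m < l j) (param l j m == param l r i)%:R * k%:R ^+ m
    = (j == r)%:R * k%:R ^+ i :> R[i].
  have [->|jr] := eqVneq j r; last first.
    rewrite mul0r big1 // => m _.
    by rewrite eq_param ?(ltnW ilr) ?(ltnW (ltn_ord m)) // (negbTE jr) mul0r.
  rewrite (bigD1 (Ordinal ilr)) //= eqxx big1 ?addr0 // => m mi.
  rewrite eq_param ?(ltnW ilr) ?(ltnW (ltn_ord m)) // eqxx /=.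
  by rewrite -val_eqE /= in mi; rewrite (negbTE mi) mul0r.
have nodeE j : (param l j (l j) == param l r i) = false.
  by rewrite eq_param ?(ltnW ilr) //; case: eqVneq => //= ->; rewrite gtn_eqF.
rewrite jacobian_mxE (bigD1 r) //= [X in _ + X]big1 => [|j jr].
  by rewrite coefE nodeE eqxx mul1r !mulr0 !addr0.
by rewrite coefE nodeE (negbTE jr) mul0r !mulr0 addr0.
Qed.

Lemma jacobian_mx_node N x (k : 'I_N) r :
  jacobian_mx N x k (param l r (l r)) =
  k%:R * node x r ^+ k.-1 * \sum_(i < l r) coef x r i * k%:R ^+ i.
Proof.
have coefE j : \sum_(m < l j) (param l j m == param l r (l r))%:R * k%:R ^+ m
    = 0 :> R[i].
  apply: big1 => m _; rewrite eq_param ?(ltnW (ltn_ord m)) //.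
  by case: eqVneq => [<-|_] /=; rewrite ?ltn_eqF ?mul0r.
rewrite jacobian_mxE (bigD1 r) //= [X in _ + X]big1 => [|j jr].
  by rewrite coefE eqxx mulr1 mulr0 add0r addr0 mulrC.
by rewrite coefE eq_param // (negbTE jr) !mulr0 addr0.
Qed.

End ParameterIndices.

(** * Rows of the pseudo-inverse *)

Local Open Scope sesquilinear_scope.

Section PseudoInverseRows.
Context {R : realType}.
Implicit Types m n : nat.

Lemma full_rank_linv m n (A : 'M[R[i]]_(m, n)) B :
  B *m A = 1%:M -> (n <= m)%N -> full_rank A.
Proof.
move=> BA nm; rewrite /full_rank (minn_idPr nm); apply/eqP.
rewrite eqn_leq rank_leq_col -[X in (X <= _)%N](mxrank1 R[i] n) -BA.
exact: mxrankM_maxr.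
Qed.

Lemma dotmx_normc n (u : 'rV[R[i]]_n) :
  (u *m u^t*) 0 0 = (\sum_k normc (u 0 k) ^+ 2)%:C%C.
Proof.
rewrite mxE rmorph_sum; apply: eq_bigr => k _.
by rewrite !mxE -normCK rmorphXn.
Qed.

(** As [A *m X] is an orthogonal projection [P], and row [a] of [X] is
    [w *m A *m X = w *m P], this is Pythagoras:
    [w w^* - (w P)(w P)^* = (w - w P)(w - w P)^*] is nonnegative. *)
Lemma moore_penrose_row_l2 m n (A : 'M[R[i]]_(m, n)) a (w : 'rV[R[i]]_m) :
  w *m A = delta_mx 0 a ->
  \sum_k normc (moore_penrose A a k) ^+ 2 <= \sum_k normc (w 0 k) ^+ 2.
Proof.
move=> wA; have [AXA XAX AXh _] := moore_penroseP A.
set X := moore_penrose A in AXA XAX AXh *; set P := A *m X in AXA AXh.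
pose v := w *m P.
have vE k : X a k = v 0 k by rewrite /v /P mulmxA wA -rowE mxE.
have PP : P *m P = P by rewrite /P !mulmxA AXA.
clearbody P.
have vv : v *m v^t* = w *m P *m w^t*.
  by rewrite /v adjM AXh mulmxA -(mulmxA w P P) PP.
have wv : w *m v^t* = w *m P *m w^t* by rewrite /v adjM AXh mulmxA.
have : w *m w^t* - v *m v^t* = (w - v) *m (w - v)^t*.
  by rewrite linearB map_mxB /= mulmxBl !mulmxBr vv wv subrr subr0.
move=> /matrixP/(_ 0 0); rewrite mxE [X in _ + X]mxE !dotmx_normc -rmorphB.
move=> /complexI e; rewrite -subr_ge0; under [X in _ - X]eq_bigr do rewrite vE.
by rewrite e sumr_ge0 // => k _; rewrite sqr_ge0.
Qed.

(** This case of the Cauchy-Schwarz inequality follows by summing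
    [2 f_i T <= f_i^2 + T^2]. *)
Lemma sum_le_of_sqr (I : finType) (f : I -> R) (T : R) :
  0 < T -> \sum_i f i ^+ 2 <= #|I|%:R * T ^+ 2 -> \sum_i f i <= #|I|%:R * T.
Proof.
move=> T0 h; rewrite -(ler_pM2r T0) mulr_suml -(@ler_pM2l _ 2%:R) //.
have amgm i : 2 * (f i * T) <= f i ^+ 2 + T ^+ 2 by have := sqr_ge0 (f i - T); nra.
rewrite mulr_sumr; apply: le_trans (ler_sum _ (fun i _ => amgm i)) _.
by rewrite big_split /= sumr_const -mulr_natl; nra.
Qed.

Lemma moore_penrose_row_l1 m n (A : 'M[R[i]]_(m, n)) a (w : 'rV[R[i]]_m) (T : R) :
  w *m A = delta_mx 0 a -> 0 < T -> (forall k, normc (w 0 k) <= T) ->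
  \sum_k normc (moore_penrose A a k) <= m%:R * T.
Proof.
move=> wA T0 wT; rewrite -[X in X%:R]card_ord; apply: sum_le_of_sqr => //.
apply: le_trans (moore_penrose_row_l2 wA) _.
rewrite mulr_natl -sumr_const; apply: ler_sum => k _.
by rewrite ler_pXn2r ?nnegrE // ?normc_ge0 ?ltW.
Qed.
End PseudoInverseRows.

(** * The Euler operator *)

Section EulerOperator.
Context {F : comNzRingType}.
Implicit Types (p q y : {poly F}) (z : F).

(** [X d/dX], the derivation that multiplies the coefficient of [X^k] by [k]. *)
Definition euler p : {poly F} := 'X * p^`().

Lemma coef_iter_euler i p k : (iter i euler p)`_k = p`_k * k%:R ^+ i.
Proof.
elim: i => [|i IH] /=; first by rewrite expr0 mulr1.
rewrite /euler coefXM coef_deriv; case: k IH => [|k] IH /=.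
  by rewrite exprS mul0r mulr0.
by rewrite IH exprSr mulrA mulr_natr.
Qed.

(** Evaluation of [D^i p] pairs the coefficients of [p] with the column
    [k^i z^k] of a confluent Vandermonde matrix. *)
Lemma horner_iter_euler i p z n : (size p <= n)%N ->
  (iter i euler p).[z] = \sum_(k < n) p`_k * k%:R ^+ i * z ^+ k.
Proof.
move=> pn; rewrite (@horner_coef_wide _ n) => [|]; last first.
  by apply/leq_sizeP => k nk; rewrite coef_iter_euler (leq_sizeP _ _ pn) ?mul0r.
by apply: eq_bigr => k _; rewrite coef_iter_euler.
Qed.

Lemma iter_eulerD i p q : iter i euler (p + q) = iter i euler p + iter i euler q.
Proof. by apply/polyP => k; rewrite !(coef_iter_euler, coefD) mulrDl. Qed.

Lemma iter_eulerZ i c p : iter i euler (c *: p) = c *: iter i euler p.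
Proof. by apply/polyP => k; rewrite !(coef_iter_euler, coefZ) mulrA. Qed.

Lemma eulerXnM y p n : euler (y ^+ n.+1 * p) =
  y ^+ n * (n.+1%:R * euler y * p + y * euler p).
Proof.
rewrite /euler derivM deriv_exp /= -mulr_natl exprS; ring.
Qed.

(** Each derivation removes at most one factor [y], and one is left when
    [i < n]. *)
Lemma horner_iter_euler_lt y p z n i : root y z -> (i < n)%N ->
  (iter i euler (y ^+ n * p)).[z] = 0.
Proof.
move=> /rootP yz; elim: n i p => // n IH [|i] p lt_in.
  by rewrite /= hornerM horner_exp yz expr0n mul0r.
by rewrite iterSr eulerXnM IH.
Qed.

(** Only the term in which the [n] derivations hit the [n] factors [y]
    survives at a root of [y]. *)
Lemma horner_iter_euler_eq y p z n : root y z ->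
  (iter n euler (y ^+ n * p)).[z] = n`!%:R * (euler y).[z] ^+ n * p.[z].
Proof.
move=> /rootP yz; elim: n p => [|n IH] p; first by rewrite !expr0 fact0 !mul1r.
rewrite iterSr eulerXnM IH hornerD !hornerM yz -polyC_natr hornerC factS natrM exprS.
ring.
Qed.

End EulerOperator.

(** * Polynomials with bounded degree and coefficients *)

Section BoundedPolynomials.
Context {R : realType}.
Implicit Types (p : {poly R[i]}) (z : R[i]) (M : R).

Definition bounded_poly (n : nat) M p :=
  (size p <= n)%N /\ forall k, normc p`_k <= M.

Lemma bounded_poly_ge0 n M p : bounded_poly n M p -> 0 <= M.
Proof. by case=> _ /(_ 0%N); apply: le_trans; exact: normc_ge0. Qed.

Lemma bounded_polyW n n' M M' p : (n <= n')%N -> M <= M' ->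
  bounded_poly n M p -> bounded_poly n' M' p.
Proof.
move=> nn' MM' [sp bp]; split=> [|k]; first exact: leq_trans sp nn'.
exact: le_trans (bp k) MM'.
Qed.

Lemma bounded_polyD n M M' p p' :
  bounded_poly n M p -> bounded_poly n M' p' -> bounded_poly n (M + M') (p + p').
Proof.
move=> [sp bp] [sp' bp']; split=> [|k].
  by rewrite (leq_trans (size_polyD _ _)) // geq_max sp.
by rewrite coefD (le_trans (le_normcD _ _)) // lerD.
Qed.

Lemma bounded_polyZ n M p c :
  bounded_poly n M p -> bounded_poly n (normc c * M) (c *: p).
Proof.
move=> [sp bp]; split=> [|k]; first exact: leq_trans (size_scale_leq _ _) sp.
by rewrite coefZ normcM ler_wpM2l ?normc_ge0.
Qed.

Lemma normc_iter_euler n M p z i : normc z = 1 -> bounded_poly n M p ->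
  normc (iter i euler p).[z] <= n%:R ^+ i.+1 * M.
Proof.
move=> z1 [sp bp]; rewrite (horner_iter_euler _ _ sp).
apply: le_trans (normc_sum _ _ _) _.
rewrite exprS -mulrA mulr_natl -[X in _ *+ X]card_ord -sumr_const.
apply: ler_sum => k _; rewrite !normcM !normcX z1 expr1n mulr1 normc_nat mulrC.
by apply: ler_pM; rewrite ?normc_ge0 ?exprn_ge0 // lerXn2r ?nnegrE // ler_nat ltnW.
Qed.

Definition binom_factor (c b : R[i]) (q : nat) : {poly R[i]} :=
  c *: ('X^q - b%:P).

(** The two terms of [c (X^q - b) p] are multiples of [p] and of a shift of [p],
    by scalars of modulus at most [B]; so the coefficient bound grows by [2 B],
    independently of the exponent [q]. *)
Lemma bounded_poly_binom n M p c b q (B : R) :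
  normc c <= B -> normc b <= 1 -> bounded_poly n M p ->
  bounded_poly (n + q) (2 * B * M) (binom_factor c b q * p).
Proof.
move=> cB b1 bdp; have M0 := bounded_poly_ge0 bdp; have [sp bp] := bdp.
have B0 : 0 <= B := le_trans (normc_ge0 _) cB.
rewrite /binom_factor -[_ *: _ * p]scalerAl; split=> [|k].
  apply: leq_trans (size_scale_leq _ _) _.
  rewrite mulrBl (leq_trans (size_polyD _ _)) // geq_max size_polyN.
  rewrite (leq_trans (size_polyMleq _ _)) ?size_polyXn; last by lia.
  by rewrite mul_polyC (leq_trans (size_scale_leq _ _)) // (leq_trans sp) ?leq_addr.
rewrite coefZ normcM mulrBl coefB coefXnM coefCM [2 * B]mulrC -mulrA.
apply: ler_pM; rewrite ?normc_ge0 //.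
apply: le_trans (le_normcD _ _) _; rewrite normcN normcM mulr2n mulrDl mul1r.
apply: lerD; first by case: ifP; rewrite ?normc0.
by rewrite -[leRHS]mul1r; apply: ler_pM; rewrite ?normc_ge0.
Qed.

Lemma bounded_poly_binomX n M p c b q e (B : R) :
  normc c <= B -> normc b <= 1 -> bounded_poly n M p ->
  bounded_poly (n + q * e) ((2 * B) ^+ e * M) (binom_factor c b q ^+ e * p).
Proof.
move=> cB b1 bp; elim: e => [|e IH]; first by rewrite muln0 addn0 !expr0 !mul1r.
by rewrite !exprS -!mulrA mulrA mulnS [(q + _)%N]addnC addnA; exact: bounded_poly_binom.
Qed.

Lemma bounded_poly_prod (I : Type) (s : seq I) (P : pred I) (c b : I -> R[i])
    (q e : I -> nat) n M p (B : R) :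
  (forall i, P i -> normc (c i) <= B) -> (forall i, P i -> normc (b i) <= 1) ->
  bounded_poly n M p ->
  bounded_poly (n + \sum_(i <- s | P i) q i * e i)
    ((2 * B) ^+ (\sum_(i <- s | P i) e i) * M)
    (\prod_(i <- s | P i) binom_factor (c i) (b i) (q i) ^+ e i * p).
Proof.
move=> cB b1 bp; elim: s => [|i s IH]; first by rewrite !big_nil addn0 expr0 !mul1r.
rewrite !big_cons; case: ifP => // Pi.
rewrite -mulrA exprD -mulrA [(_ * _ + _)%N]addnC addnA.
by apply: bounded_poly_binomX; rewrite ?cB ?b1.
Qed.

End BoundedPolynomials.

(** * Hermite dual polynomials *)

(** The exponents [q r] and [s], the bound [beta] on the inverse chords and the
    ratio [tau] of [N] to [s] are parameters, because two choices are needed: one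
    adapted to the separation of the nodes, for the estimates, and [q = s = 1],
    for the rank.  [budget] says that the degrees fit below [N]. *)
Section HermiteDual.
Context {R : realType} {K : nat} (l : 'I_K -> nat).
Variables (z : 'I_K -> R[i]) (j : 'I_K) (q : 'I_K -> nat) (s N : nat).
Variables (beta tau : R).
Hypothesis z1 : forall r, normc (z r) = 1.
Hypotheses (beta1 : 1 <= beta) (tau1 : 1 <= tau).
Hypotheses (s0 : (0 < s)%N) (Ns : N%:R <= tau * s%:R).
Hypothesis zq : forall r, r != j -> z j ^+ q r != z r ^+ q r.
Hypothesis zbeta :
  forall r, r != j -> normc (z j ^+ q r - z r ^+ q r)^-1 <= beta.
Hypothesis budget :
  (s * (l j).+1 + \sum_(r < K | r != j) q r * (l r).+1 <= N)%N.

(** Vanishes to order [l r + 1] at each other node, and is [1] at [z j]. *)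
Definition separator : {poly R[i]} :=
  \prod_(r < K | r != j)
     binom_factor (z j ^+ q r - z r ^+ q r)^-1 (z r ^+ q r) (q r) ^+ (l r).+1.

(** Has value [1] at [z j] with coefficients of modulus only [1 / s]: this is
    the source of the factor [1 / N] common to all the bounds. *)
Definition window : {poly R[i]} := \poly_(k < s) (s%:R^-1 * z j ^- k).

Definition local_factor : {poly R[i]} := binom_factor (z j ^- s) (z j ^+ s) s.

(** Normalised so that [D^i] at [z j] is [0] for [i < m] and [1] for [i = m]; the
    values for [i > m] are not yet controlled. *)
Definition hermite_start (m : nat) : {poly R[i]} :=
  (m`!%:R * s%:R ^+ m)^-1 *: (local_factor ^+ m * (separator * window)).

Let z0 r : z r != 0. Proof. by rewrite -normc_eq0 z1 oner_eq0. Qed.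

Let sC0 : s%:R != 0 :> R[i]. Proof. by rewrite pnatr_eq0 -lt0n. Qed.

Let beta0 : 0 <= beta. Proof. exact: le_trans beta1. Qed.

Lemma root_local_factor : root local_factor (z j).
Proof. by apply/rootP; rewrite !hornerE subrr mulr0. Qed.

Lemma euler_local_factor : (euler local_factor).[z j] = s%:R.
Proof.
rewrite /euler /local_factor /binom_factor derivZ derivB derivXn derivC subr0.
rewrite hornerM hornerX hornerZ hornerMn hornerXn -mulr_natl mulrA [z j * _]mulrC.
rewrite -!mulrA [z j * _]mulrCA -exprS prednK // mulrC -mulrA mulfV ?mulr1 //.
by rewrite expf_neq0.
Qed.

Lemma window_at : window.[z j] = 1.
Proof.
rewrite horner_poly (eq_bigr (fun=> s%:R^-1)) => [|k _].
  by rewrite sumr_const card_ord -[_^-1 *+ s]mulr_natl mulfV.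
by rewrite mulfVK // expf_neq0.
Qed.

Lemma separator_at : separator.[z j] = 1.
Proof.
rewrite horner_prod big1 // => r rj; rewrite horner_exp !hornerE.
by rewrite mulVf ?expr1n // subr_eq0 zq.
Qed.

Lemma hermite_start_other m r i : r != j -> (i <= l r)%N ->
  (iter i euler (hermite_start m)).[z r] = 0.
Proof.
move=> rj ilr; rewrite iter_eulerZ hornerZ /separator (bigD1 r) //=.
rewrite -[_ * _ * window]mulrA mulrCA horner_iter_euler_lt ?mulr0 //.
by apply/rootP; rewrite !hornerE subrr mulr0.
Qed.

Lemma hermite_start_lt m i : (i < m)%N ->
  (iter i euler (hermite_start m)).[z j] = 0.
Proof.
move=> im; rewrite iter_eulerZ hornerZ horner_iter_euler_lt ?mulr0 //.
exact: root_local_factor.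
Qed.

Lemma hermite_start_eq m : (iter m euler (hermite_start m)).[z j] = 1.
Proof.
rewrite iter_eulerZ hornerZ (horner_iter_euler_eq _ _ root_local_factor).
rewrite euler_local_factor hornerM separator_at window_at !mulr1 mulVf //.
by rewrite mulf_neq0 ?expf_neq0 // pnatr_eq0 -lt0n fact_gt0.
Qed.

Definition hermite_const : R := (2 * beta) ^+ nparams l * tau ^+ nparams l.

Lemma N_gt0 : (0 < N)%N.
Proof. by rewrite (leq_trans _ budget) // addn_gt0 muln_gt0 s0. Qed.

(** There are [m + \sum_(r != j) (l r).+1 <= nparams l] binomial factors, each
    costing [2 beta]; the scaling [s^-m] and the window give [s^-(m+1)], which is
    compared with [N^-(m+1)] through [N <= tau s]. *)
Lemma bounded_hermite_start m : (m <= l j)%N ->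
  bounded_poly N (hermite_const / N%:R ^+ m.+1) (hermite_start m).
Proof.
move=> mlj; have sR0 : 0 < s%:R :> R by rewrite ltr0n.
have NR0 : 0 < N%:R :> R by rewrite ltr0n N_gt0.
have bw : bounded_poly s s%:R^-1 window.
  split=> [|k]; first exact: size_poly.
  rewrite coef_poly; case: ifP => _; last by rewrite normc0 invr_ge0 ltW.
  by rewrite normcM !normcV normcX z1 expr1n invr1 mulr1 normc_nat.
have zX r e : normc (z r ^+ e) = 1 by rewrite normcX z1 expr1n.
have zle r e : normc (z r ^+ e) <= 1 by rewrite zX.
have bsw := @bounded_poly_prod R _ (index_enum 'I_K) (fun r => r != j) _ _ q
  (fun r => (l r).+1) s _ _ beta zbeta (fun r _ => zle r (q r)) bw.
have bY : normc (z j ^- s) <= beta by rewrite normcV zX invr1.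
have bYsw := bounded_poly_binomX s m bY (zle j s) bsw.
apply: bounded_polyW (bounded_polyZ (m`!%:R * s%:R ^+ m)^-1 bYsw).
  apply: leq_trans budget; rewrite mulnS addnAC.
  by rewrite leq_add2r leq_add2l leq_mul2l mlj orbT.
rewrite normcV normcM normcX !normc_nat mulrA -exprD invfM.
set e := (m + _)%N.
have eP : (e <= nparams l)%N.
  by rewrite nparamsE (bigD1 j) //= leq_add2r ltnW.
have b2 : 1 <= 2 * beta by rewrite (le_trans beta1) // ler_peMl ?ler1n.
have le1 : (2 * beta) ^+ e <= (2 * beta) ^+ nparams l by exact: ler_weXn2l.
have le2 : m`!%:R^-1 <= 1 :> R by rewrite invf_le1 ?ltr0n ?ler1n fact_gt0.
have le3 : s%:R ^- m.+1 <= tau ^+ nparams l / N%:R ^+ m.+1.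
  rewrite ler_pdivlMr ?exprn_gt0 // ler_pdivrMl ?exprn_gt0 // mulrC.
  have : N%:R ^+ m.+1 <= (tau * s%:R) ^+ m.+1.
    by rewrite lerXn2r ?nnegrE ?(ltW NR0) ?mulr_ge0 ?(ltW sR0) ?(le_trans ler01 tau1).
  move=> /le_trans -> //; rewrite exprMn ler_wpM2r ?exprn_ge0 ?(ltW sR0) //.
  apply: ler_weXn2l => //.
  by rewrite nparamsE (bigD1 j) //= (leq_trans _ (leq_addr _ _)).
rewrite /hermite_const -mulrA.
have -> : m`!%:R^-1 / s%:R ^+ m * ((2 * beta) ^+ e / s%:R)
  = m`!%:R^-1 * ((2 * beta) ^+ e * s%:R ^- m.+1)
    :> R
  by rewrite exprSr invfM mulrACA -[LHS]mulrA.
have b0 : 0 <= (2 * beta) ^+ e by rewrite exprn_ge0 ?(le_trans ler01 b2).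
have s1 : 0 <= s%:R ^- m.+1 :> R by rewrite invr_ge0 exprn_ge0 ?(ltW sR0).
rewrite -[leRHS]mul1r; apply: ler_pM => //; first by rewrite invr_ge0.
  by rewrite mulr_ge0.
by apply: ler_pM.
Qed.

Lemma hermite_const_ge0 : 0 <= hermite_const.
Proof. by rewrite mulr_ge0 ?exprn_ge0 ?mulr_ge0 ?(le_trans ler01 tau1). Qed.

(** Induction on the number [d] of corrected values.  The next one,
    [c = (D^t W)(z j)], is at most [N^(t+1)] times the coefficient bound of [W],
    while the correcting polynomial [hermite_start t] has coefficients at most
    [b / N^(t+1)]: the powers of [N] cancel, and the bound grows by [1 + b].  The
    correction does not disturb the values of [D^i] for [i < t]. *)
Lemma hermite_correction m d : (m + d <= l j)%N ->
  exists W : {poly R[i]},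
    [/\ bounded_poly N (hermite_const * (1 + hermite_const) ^+ d / N%:R ^+ m.+1) W,
        forall r i, r != j -> (i <= l r)%N -> (iter i euler W).[z r] = 0 &
        forall i, (i <= m + d)%N -> (iter i euler W).[z j] = (i == m)%:R].
Proof.
have NR0 : 0 < N%:R :> R by rewrite ltr0n N_gt0.
set b := hermite_const.
elim: d => [|d IH] mdl.
  rewrite addn0 in mdl; exists (hermite_start m); split=> [||i].
  - by rewrite expr0 mulr1; exact: bounded_hermite_start.
  - by move=> r i rj ilr; exact: hermite_start_other.
  - rewrite addn0 leq_eqVlt => /orP[/eqP ->|im].
      by rewrite eqxx hermite_start_eq.
    by rewrite hermite_start_lt // ltn_eqF.
rewrite addnS in mdl; have [W [bW Wother Wj]] := IH (ltnW mdl).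
set t := (m + d).+1 in mdl *.
pose c := (iter t euler W).[z j].
exists (W + (- c) *: hermite_start t); split=> [|r i rj ilr|i].
- have bE := bounded_polyZ (- c) (bounded_hermite_start mdl).
  apply: bounded_polyW (leqnn _) _ (bounded_polyD bW bE).
  have cle := normc_iter_euler t (z1 j) bW; rewrite -/c in cle.
  rewrite [_ ^+ d.+1]exprS [(1 + b) * _]mulrDl mul1r mulrDr [leRHS]mulrDl lerD2l normcN.
  have -> : b * (b * (1 + b) ^+ d) / N%:R ^+ m.+1 =
     (N%:R ^+ t.+1 * (b * (1 + b) ^+ d / N%:R ^+ m.+1)) * (b / N%:R ^+ t.+1).
    by field; rewrite !expf_neq0 // gt_eqF.
  apply: ler_wpM2r => //; rewrite mulr_ge0 ?hermite_const_ge0 //.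
  by rewrite invr_ge0 exprn_ge0 // ltW.
- by rewrite iter_eulerD iter_eulerZ !hornerE Wother // hermite_start_other // mulr0 addr0.
- rewrite iter_eulerD iter_eulerZ hornerD hornerZ addnS -/t leq_eqVlt => /orP[/eqP ->|it].
    by rewrite hermite_start_eq mulr1 -/c subrr gtn_eqF // /t ltnS leq_addr.
  by rewrite hermite_start_lt // mulr0 addr0 Wj.
Qed.

Lemma hermite_dual_poly m : (m <= l j)%N ->
  exists W : {poly R[i]},
    bounded_poly N
      (hermite_const * (1 + hermite_const) ^+ nparams l / N%:R ^+ m.+1) W /\
    forall r i, (i <= l r)%N ->
      (iter i euler W).[z r] = ((r == j) && (i == m))%:R.
Proof.
move=> mlj; have mdl : (m + (l j - m) <= l j)%N by rewrite subnKC.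
have [W [bW Wother Wj]] := hermite_correction mdl.
have b0 := hermite_const_ge0; set b := hermite_const in b0 bW *.
exists W; split=> [|r i ilr]; last first.
  have [rj|rj] := eqVneq r j; last by rewrite Wother.
  by rewrite rj Wj ?subnKC // -rj.
apply: bounded_polyW bW => //.
rewrite ler_wpM2r ?invr_ge0 ?exprn_ge0 // ler_wpM2l //.
apply: ler_weXn2l; first by rewrite lerDl.
by rewrite nparamsE (bigD1 j) //= leqW // (leq_trans (leq_subr _ _)) // leq_addr.
Qed.

End HermiteDual.

(** * Separation of nodes by powers *)

Section AngularSeparation.
Context {R : realType}.
Implicit Types (z w : R[i]) (t : R).

Definition cis t : R[i] := (cos t +i* sin t)%C.

Lemma cisX t n : cis t ^+ n = cis (n%:R * t).
Proof.
elim: n => [|n IH]; first by rewrite expr0 mul0r /cis cos0 sin0.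
rewrite exprS IH -[n.+1]add1n natrD mulrDl mul1r /cis cosD sinD.
apply/eqP; rewrite eq_complex /=; apply/andP; split; apply/eqP; ring.
Qed.

Lemma cis_arg z : normc z = 1 -> z = cis (arg z).
Proof. by move=> z1; have [_] := argP z; rewrite z1 mul1r. Qed.

Lemma normc_cisB t t' : normc (cis t - cis t') ^+ 2 = 2 - 2 * cos (t - t').
Proof.
rewrite sqr_sqrtr ?addr_ge0 ?sqr_ge0 // cosB.
by have := cos2Dsin2 t; have := cos2Dsin2 t'; nra.
Qed.

Lemma cos_periodic t n : cos (n%:R * (2 * pi) - t) = cos t :> R.
Proof.
rewrite -[RHS]cosN -[RHS](periodicn (@cosD2pi R) n); congr cos.
rewrite -[pi *+ 2 *+ n]mulr_natl -[pi *+ 2]mulr_natl; ring.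
Qed.

Lemma cos_angle_dist z w n :
  cos (n%:R * angle_dist z w) = cos (n%:R * (arg z - arg w)).
Proof.
rewrite -[RHS]cos_norm normrM normr_nat /angle_dist /Order.min.
by case: ifP => // _; rewrite mulrBr cos_periodic.
Qed.

Lemma angle_dist_lepi z w : angle_dist z w <= pi.
Proof. by rewrite /angle_dist ge_min; apply/orP; lra. Qed.

Lemma cos_le0_pihalf t : pi / 2 <= t <= pi -> cos t <= 0.
Proof.
move=> /andP[t1 t2]; rewrite -oppr_ge0 -cosDpi -cosN.
rewrite -(cosD2pi (- (t + pi))); apply: cos_ge0_pihalf.
have pi0 := pi_gt0 R.
by rewrite [pi *+ 2]mulr2n; apply/andP; split; lra.
Qed.

(** With [q] the integer part of [pi / angle_dist z w], the angle between the
    powers is between [pi / 2] and [pi], where the chord is at least [sqrt 2]. *)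
Lemma power_separates z w (eta : R) : normc z = 1 -> normc w = 1 ->
  0 < eta -> eta <= angle_dist z w ->
  exists q : nat, [/\ q%:R <= pi / eta & 1 <= normc (z ^+ q - w ^+ q)].
Proof.
move=> z1 w1 eta0 etad; set d := angle_dist z w in etad.
have d0 : 0 < d := lt_le_trans eta0 etad.
have dpi : d <= pi := angle_dist_lepi z w.
have pi0 := pi_gt0 R.
exists (Num.truncn (pi / d)); set q := Num.truncn _.
have /andP[q1 q2] : q%:R <= pi / d < q.+1%:R by rewrite truncn_itv ?divr_ge0 ?ltW.
have q0 : (0 < q)%N by rewrite truncn_gt0 ler_pdivlMr ?mul1r.
split; first by rewrite (le_trans q1) // ler_pM2l // lef_pV2 ?posrE.
have cosle : cos (q%:R * (arg z - arg w)) <= 0.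
  rewrite -cos_angle_dist -/d; apply: cos_le0_pihalf.
  rewrite [X in _ && X](_ : _ = true) ?andbT; last by rewrite -ler_pdivlMr.
  rewrite ltr_pdivrMr // -natr1 in q2.
  have : 1 <= q%:R :> R by rewrite ler1n.
  by nra.
rewrite -(@ler_pXn2r _ 2) ?nnegrE ?normc_ge0 //.
rewrite (cis_arg z1) (cis_arg w1) !cisX normc_cisB -mulrBr expr1n; lra.
Qed.

Lemma angle_dist_neq z w : 0 < angle_dist z w -> z != w.
Proof.
apply: contraTneq => ->; rewrite /angle_dist subrr normr0 -leNgt ge_min lexx //.
Qed.

Lemma min_separation_le K (l : 'I_K -> nat) (x : 'rV[R[i]]_(nparams l)) j r :
  r != j -> min_separation x <= angle_dist (node x j) (node x r).
Proof.
move=> rj; apply: (@le_trans _ _ (node_separation x j)); first exact: bigmin_le.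
exact: bigmin_le_cond.
Qed.

Lemma min_separation_lepi K (l : 'I_K -> nat) (x : 'rV[R[i]]_(nparams l)) :
  min_separation x <= pi.
Proof. exact: bigmin_le_id. Qed.

End AngularSeparation.

(** * From dual polynomials to condition numbers *)

Lemma delta_rows_linv (F : fieldType) m n (A : 'M[F]_(m, n)) :
  (forall a, exists w : 'rV_m, w *m A = delta_mx 0 a) ->
  exists B : 'M_(n, m), B *m A = 1%:M.
Proof.
move=> /choice[f fA]; exists (\matrix_a f a); apply/row_matrixP => a.
by rewrite row_mul rowK fA row1.
Qed.

Section DualRows.
Context {R : realType} {K : nat} (l : 'I_K -> nat) (N : nat).
Variable x : 'rV[R[i]]_(nparams l).
Hypothesis l_gt0 : forall j, (0 < l j)%N.
Hypothesis z1 : forall j, normc (node x j) = 1.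
Hypothesis a0 : forall j, coef x j (l j).-1 != 0.
Implicit Types (W : {poly R[i]}) (j r : 'I_K).

Definition hermite_dual j m W :=
  forall r i, (i <= l r)%N ->
    (iter i euler W).[node x r] = ((r == j) && (i == m))%:R.

Let z0 j : node x j != 0. Proof. by rewrite -normc_eq0 z1 oner_eq0. Qed.

Lemma poly_rV_mul_coef W r i : (size W <= N)%N -> (i < l r)%N ->
  (poly_rV W *m jacobian_mx N x) 0 (param l r i) = (iter i euler W).[node x r].
Proof.
move=> sW ilr; rewrite (horner_iter_euler _ _ sW) mxE; apply: eq_bigr => k _.
by rewrite jacobian_mx_coef // mxE mulrA mulrAC.
Qed.

(** The derivative of the moment [k] with respect to [z_r] is
    [k z_r^(k-1) \sum_i a_i k^i], which is [z_r^-1 \sum_i a_i k^(i+1) z_r^k]. *)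
Lemma poly_rV_mul_node W r : (size W <= N)%N ->
  (poly_rV W *m jacobian_mx N x) 0 (param l r (l r)) =
  (node x r)^-1 * \sum_(i < l r) coef x r i * (iter i.+1 euler W).[node x r].
Proof.
move=> sW; rewrite mxE mulr_sumr.
under [RHS]eq_bigr => i _ do rewrite (horner_iter_euler _ _ sW) mulrA mulr_sumr.
rewrite exchange_big /=; apply: eq_bigr => k _.
rewrite jacobian_mx_node mxE !mulr_sumr; apply: eq_bigr => i _.
case: (k : nat) => [|k' /=]; first by rewrite exprS !(mul0r, mulr0).
by rewrite !exprS; field; exact: z0.
Qed.

Lemma sum_coef_pred j m : (m <= l j)%N ->
  \sum_(i < l j) coef x j i * (i.+1 == m)%:R = coef_pred x j m.
Proof.
case: m => [|m] mlj; first by rewrite big1 // => i _; rewrite mulr0.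
rewrite (bigD1 (Ordinal mlj)) //= eqxx mulr1 big1 ?addr0 // => i.
by rewrite -val_eqE /= eqSS => /negbTE ->; rewrite mulr0.
Qed.

Lemma coef_pred_last j : coef_pred x j (l j) = coef x j (l j).-1.
Proof. by have := l_gt0 j; case: (l j). Qed.

Lemma row_dual_eq W a : (size W <= N)%N ->
  (forall r i, (i < l r)%N -> (iter i euler W).[node x r] = (param l r i == a)%:R) ->
  (forall r, \sum_(i < l r) coef x r i * (iter i.+1 euler W).[node x r]
     = node x r * (param l r (l r) == a)%:R) ->
  poly_rV W *m jacobian_mx N x = delta_mx 0 a.
Proof.
move=> sW Wcoef Wnode; apply/rowP => b; have [r [i [ilr ->]]] := param_surj b.
rewrite [RHS]mxE eqxx /=; move: ilr; rewrite leq_eqVlt => /orP[/eqP ->|ilr].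
  by rewrite poly_rV_mul_node // Wnode mulKf.
by rewrite poly_rV_mul_coef // Wcoef.
Qed.

(** [W] alone is dual to all the columns but that of [z_j], with which it pairs to
    [z_j^-1 a_{m-1}]; the multiple of [W'], which pairs to
    [z_j^-1 a_{l_j-1}] with this column and to [0] with the others, cancels it. *)
Lemma coef_dual_row j m W W' : (m < l j)%N ->
  (size W <= N)%N -> (size W' <= N)%N ->
  hermite_dual j m W -> hermite_dual j (l j) W' ->
  poly_rV (W + (- (coef_pred x j m / coef x j (l j).-1)) *: W')
    *m jacobian_mx N x = delta_mx 0 (param l j m).
Proof.
move=> mlj sW sW' dW dW'; set c := _ / _.
have sWW : (size (W + (- c) *: W')%R <= N)%N.
  rewrite (leq_trans (size_polyD _ _)) // geq_max sW.
  exact: leq_trans (size_scale_leq _ _) sW'.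
have eval r i : (i <= l r)%N -> (iter i euler (W + (- c) *: W')).[node x r]
    = ((r == j) && (i == m))%:R - c * ((r == j) && (i == l j))%:R.
  by move=> ilr; rewrite iter_eulerD iter_eulerZ hornerD hornerZ dW // dW' // mulNr.
apply: row_dual_eq => // [r i ilr|r].
  rewrite eval ?(ltnW ilr) // eq_param ?(ltnW ilr) ?(ltnW mlj) //.
  case: eqVneq ilr => [->|_] ilr /=; last by rewrite mulr0 subr0.
  by rewrite [i == l j]ltn_eqF // mulr0 subr0.
rewrite eq_param ?(ltnW mlj) //; under eq_bigr => i _ do rewrite eval //.
case: eqVneq => [->|_] /=; last first.
  by rewrite [RHS]mulr0 big1 // => i _; rewrite !(mulr0, subr0).
rewrite gtn_eqF // mulr0; under eq_bigr do rewrite mulrBr mulrCA.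
by rewrite sumrB -mulr_sumr !sum_coef_pred ?(ltnW mlj) // coef_pred_last /c divfK ?subrr.
Qed.

Lemma node_dual_row j W : (size W <= N)%N -> hermite_dual j (l j) W ->
  poly_rV ((node x j / coef x j (l j).-1) *: W) *m jacobian_mx N x
  = delta_mx 0 (param l j (l j)).
Proof.
move=> sW dW; set c := _ / _.
have eval r i : (i <= l r)%N -> (iter i euler (c *: W)).[node x r]
    = c * ((r == j) && (i == l j))%:R.
  by move=> ilr; rewrite iter_eulerZ hornerZ dW.
apply: row_dual_eq => [|r i ilr|r].
- exact: leq_trans (size_scale_leq _ _) sW.
- rewrite eval ?(ltnW ilr) // eq_param ?(ltnW ilr) //.
  case: eqVneq ilr => [->|_] ilr /=; last by rewrite mulr0.
  by rewrite ltn_eqF // mulr0.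
rewrite eq_param //; under eq_bigr => i _ do rewrite eval //.
case: eqVneq => [->|_] /=; last first.
  by rewrite [RHS]mulr0 big1 // => i _; rewrite !mulr0.
under eq_bigr do rewrite mulrCA.
by rewrite -mulr_sumr sum_coef_pred // coef_pred_last /c eqxx mulr1 divfK.
Qed.

Lemma dual_polys_linv :
  (forall j m, (m <= l j)%N ->
    exists2 W : {poly R[i]}, (size W <= N)%N & hermite_dual j m W) ->
  exists B, B *m jacobian_mx N x = 1%:M.
Proof.
move=> dual; apply: delta_rows_linv => a; have [j [m [mlj ->]]] := param_surj a.
have [W' sW' dW'] := dual j _ (leqnn _).
move: mlj; rewrite leq_eqVlt => /orP[/eqP ->|mlj].
  by eexists; exact: node_dual_row sW' dW'.
have [W sW dW] := dual j m (ltnW mlj).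
by eexists; exact: coef_dual_row mlj sW sW' dW dW'.
Qed.

Lemma normc_moment (A : R) (k : nat) :
  (forall j i, (i < l j)%N -> normc (coef x j i) <= A) -> (k < N)%N ->
  normc (moment x k)
    <= (nparams l)%:R * A * N%:R ^+ (\max_(j < K) l j).-1.
Proof.
move=> aA kN; set L := (\max_(j < K) l j)%N.
have N1 : 1 <= N%:R :> R by rewrite ler1n (leq_trans _ kN).
have term j (i : 'I_(l j)) : normc (coef x j i * k%:R ^+ i) <= A * N%:R ^+ L.-1.
  rewrite normcM normcX normc_nat; apply: ler_pM; rewrite ?normc_ge0 ?exprn_ge0 //.
    exact: aA.
  apply: (@le_trans _ _ (N%:R ^+ i)).
    by rewrite lerXn2r ?nnegrE // ler_nat ltnW.
  apply: ler_weXn2l => //; have := leq_trans (ltn_ord i) (leq_bigmax (F := l) j).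
  by rewrite -/L; case: L.
have inner j : normc (node x j ^+ k * \sum_(i < l j) coef x j i * k%:R ^+ i)
    <= (l j).+1%:R * (A * N%:R ^+ L.-1).
  rewrite normcM normcX z1 expr1n mul1r; apply: le_trans (normc_sum _ _ _) _.
  apply: le_trans (ler_sum _ (fun i _ => term j i)) _.
  rewrite sumr_const card_ord -[_ *+ l j]mulr_natl ler_wpM2r ?ler_nat //.
  exact: le_trans (normc_ge0 _) (term j (Ordinal (l_gt0 j))).
apply: le_trans (normc_sum _ _ _) _; apply: le_trans (ler_sum _ (fun j _ => inner j)) _.
by rewrite -mulr_suml nparamsE natr_sum mulrA.
Qed.

Lemma cond_num_le (A T : R) a (w : 'rV[R[i]]_N) :
  (forall j i, (i < l j)%N -> normc (coef x j i) <= A) -> 0 <= A ->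
  w *m jacobian_mx N x = delta_mx 0 a -> 0 < T -> (forall k, normc (w 0 k) <= T) ->
  cond_num N x a <=
    (nparams l)%:R * A * N%:R ^+ (\max_(j < K) l j).-1 * (N%:R * T).
Proof.
move=> aA A0 wJ T0 wT; set M := _ * _ ^+ _.
have M0 : 0 <= M by rewrite !mulr_ge0 ?exprn_ge0.
apply: (@le_trans _ _ (\sum_k normc (moore_penrose (jacobian_mx N x) a k) * M)).
  by apply: ler_sum => k _; rewrite ler_wpM2l ?normc_ge0 // normc_moment.
rewrite -mulr_suml mulrC ler_wpM2l //.
exact: moore_penrose_row_l1 wJ T0 wT.
Qed.

End DualRows.

(** * Choice of the exponents and conclusion *)

Section MainEstimates.
Context {R : realType} {K : nat} (l : 'I_K -> nat).
Variables (K_gt0 : (0 < K)%N) (l_gt0 : forall j, (0 < l j)%N).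
Variable x : 'rV[R[i]]_(nparams l).
Hypothesis z1 : forall j, normc (node x j) = 1.
Hypothesis sep0 : 0 < min_separation x.

Local Notation P := (nparams l).

Let P_gt0 : (0 < P)%N.
Proof. by rewrite /nparams addn_gt0 K_gt0 orbT. Qed.

Let node_neq r j : r != j -> node x j != node x r.
Proof.
by move=> rj; apply/angle_dist_neq/(lt_le_trans sep0); exact: min_separation_le.
Qed.

Lemma jacobian_mx_linv N : (P <= N)%N -> (forall j, coef x j (l j).-1 != 0) ->
  exists B, B *m jacobian_mx N x = 1%:M.
Proof.
move=> PN a0; apply: dual_polys_linv => // j m mlj.
pose beta := 1 + \sum_(r < K) normc (node x j - node x r)^-1.
have beta1 : 1 <= beta by rewrite lerDl sumr_ge0 // => r _; exact: normc_ge0.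
have N1 : 1 <= N%:R :> R by rewrite ler1n (leq_trans P_gt0).
have := @hermite_dual_poly R K l (node x) j (fun=> 1%N) 1 N beta N%:R z1 beta1 N1.
case/(_ _ _ _ _ _ m mlj) => //.
- by rewrite mulr1.
- by move=> r rj; rewrite !expr1 node_neq.
- move=> r rj; rewrite !expr1 /beta (bigD1 r) //= addrCA lerDl.
  by rewrite addr_ge0 // sumr_ge0 // => k _; exact: normc_ge0.
- rewrite mul1n (leq_trans _ PN) // nparamsE [leqRHS](bigD1 j) //= leq_add2l.
  by apply: leq_sum => r _; rewrite mul1n.
- by move=> W [[sW _] dW]; exists W.
Qed.

Definition dual_const : R :=
  hermite_const l 1 (4 * P%:R) * (1 + hermite_const l 1 (4 * P%:R)) ^+ P.

(** The degree [N] is shared equally: with [s] the integer part of [N / (2 P)], the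
    local part uses at most [s P <= N / 2], and the separating part at most
    [(pi / eta) P <= N / 2].  As [eta <= pi], the hypothesis forces [2 P <= N],
    so that [s] is positive and [N <= 4 P s]. *)
Lemma dual_poly_exists N j m :
  2 * pi * P%:R * (min_separation x)^-1 < N%:R -> (m <= l j)%N ->
  exists W : {poly R[i]},
    bounded_poly N (dual_const / N%:R ^+ m.+1) W /\ hermite_dual x j m W.
Proof.
move=> Nbig mlj; have pi0 := pi_gt0 R; have seppi := min_separation_lepi x.
have P1 : 1 <= P%:R :> R by rewrite ler1n.
have /choice[q qP] : forall r, exists q : nat, r != j ->
    q%:R <= pi / min_separation x /\ 1 <= normc (node x j ^+ q - node x r ^+ q).
  move=> r; have [_|rj] := eqVneq r j; first by exists 0%N.
  have [|q [q1 q2]] := power_separates (z1 j) (z1 r) sep0; last by exists q.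
  exact: min_separation_le.
have piN : 2 * (pi / min_separation x) * P%:R < N%:R.
  by apply: le_lt_trans Nbig; rewrite le_eqVlt; apply/orP; left; apply/eqP; ring.
have PN : (2 * P <= N)%N.
  rewrite -(ler_nat R) natrM; apply: le_trans (ltW piN).
  by rewrite ler_wpM2r // ler_peMr // ler_pdivlMr // mul1r.
pose s := (N %/ (2 * P))%N.
have P20 : (0 < 2 * P)%N by rewrite muln_gt0.
have s0 : (0 < s)%N by rewrite divn_gt0.
have Ns : (N <= 4 * P * s)%N.
  have := divn_eq N (2 * P); have := ltn_pmod N P20; rewrite -/s => h1 h2.
  have : (2 * P <= s * (2 * P))%N by rewrite leq_pmull.
  lia.
have sN : (s * (2 * P) <= N)%N by exact: leq_trunc_div.
have budget : (s * (l j).+1 + \sum_(r < K | r != j) q r * (l r).+1 <= N)%N.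
  have sum_le : (2 * \sum_(r < K | r != j) q r * (l r).+1 <= N)%N.
    rewrite -(ler_nat R) natrM; apply: le_trans (ltW piN).
    rewrite -mulrA ler_wpM2l // natr_sum.
    apply: (@le_trans _ _ (\sum_(r < K | r != j) pi / min_separation x * (l r).+1%:R)).
      apply: ler_sum => r rj; rewrite natrM ler_wpM2r //.
      by have [] := qP r rj.
    rewrite -mulr_sumr ler_wpM2l ?divr_ge0 ?ltW // -natr_sum ltr_nat.
    by rewrite nparamsE [ltnRHS](bigD1 j) //= addSn ltnS leq_addl.
  have : (s * (l j).+1 <= s * P)%N.
    by rewrite leq_mul2l nparamsE [X in (_ < X)%N](bigD1 j) //= leq_addr orbT.
  lia.
have tau1 : 1 <= 4 * P%:R :> R by rewrite -natrM ler1n muln_gt0.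
apply: (@hermite_dual_poly R K l (node x) j q s N 1 (4 * P%:R)) => //.
- by rewrite -!natrM ler_nat.
- move=> r rj; have [_] := qP r rj; apply: contraTneq => ->.
  by rewrite subrr normc0 -ltNge ltr01.
- move=> r rj; have [_ q2] := qP r rj.
  by rewrite normcV invf_le1 // (lt_le_trans ltr01).
Qed.

End MainEstimates.

Lemma div1_exprz_sub (F : fieldType) (y : F) (a b : nat) : y != 0 ->
  1 / y ^ (a%:Z - b%:Z) = y ^+ b / y ^+ a.
Proof. by move=> y0; rewrite expfzDr // -invr_expz div1r invfM invrK mulrC. Qed.

Theorem theorem2p1 (R : realType) (K : nat) (l : 'I_K -> nat)
    (K_gt0 : (0 < K)%N) (l_gt0 : forall j, (0 < l j)%N) :
  exists c C1 C2 : R,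
    forall (x : 'rV[R[i]]_(nparams l)) (A : R),
      (forall j, normc (node x j) = 1) ->
      0 < min_separation x ->
      (forall j, coef x j (l j).-1 != 0) ->
      (forall j k, (k < l j)%N -> normc (coef x j k) <= A) ->
      forall N : nat, (nparams l <= N)%N ->
        full_rank (jacobian_mx N x) /\
        (c * (min_separation x)^-1 < N%:R ->
         forall j : 'I_K,
           (forall k : nat, (k < l j)%N ->
              cond_num N x (param l j k) <=
                C1 * A
                * (1 + normc (coef_pred x j k) / normc (coef x j (l j).-1))
                * (1 / N%:R ^ (k.+1%:Z - (\max_(i < K) l i)%N%:Z))) /\
           cond_num N x (param l j (l j)) <=
             C2 * A * (1 / normc (coef x j (l j).-1))
             * (1 / N%:R ^ ((l j).+1%:Z - (\max_(i < K) l i)%N%:Z))).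
Proof.
have pi0 := pi_gt0 R.
have P0 : (0 < nparams l)%N by rewrite /nparams addn_gt0 K_gt0 orbT.
pose H : R := dual_const l.
have H0 : 0 < H.
  have h0 : 0 < hermite_const l 1 (4 * (nparams l)%:R) :> R.
    by rewrite mulr_gt0 ?exprn_gt0 ?mulr_gt0 ?ltr0n.
  by rewrite mulr_gt0 ?exprn_gt0 ?addr_gt0.
exists (2 * pi * (nparams l)%:R), ((nparams l)%:R * H), ((nparams l)%:R * H).
move=> x A z1 sep0 a0 aA N PN; split.
  have [B BJ] := jacobian_mx_linv K_gt0 l_gt0 z1 sep0 PN a0.
  exact: full_rank_linv BJ PN.
move=> Nbig j.
have N0 : 0 < N%:R :> R by rewrite ltr0n (leq_trans P0).
have A0 : 0 <= A := le_trans (normc_ge0 _) (aA j _ (l_gt0 j)).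
have alast : 0 < normc (coef x j (l j).-1) by rewrite lt0r normc_eq0 a0 normc_ge0.
set L := (\max_(i < K) l i)%N.
have L0 : (0 < L)%N by rewrite (leq_trans (l_gt0 j)) // (leq_bigmax (F := l) j).
have NL : N%:R ^+ L = N%:R ^+ L.-1 * N%:R :> R by rewrite -exprSr prednK.
have [W' [bW' dW']] := dual_poly_exists K_gt0 z1 sep0 Nbig (leqnn (l j)).
split=> [k klj|].
  have [W [bW dW]] := dual_poly_exists K_gt0 z1 sep0 Nbig (ltnW klj).
  set a := normc (coef_pred x j k) / _.
  have a_ge0 : 0 <= a by rewrite divr_ge0 ?normc_ge0.
  have wJ := coef_dual_row l_gt0 z1 a0 klj bW.1 bW'.1 dW dW'.
  have T0 : 0 < (1 + a) * (H / N%:R ^+ k.+1).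
    by rewrite mulr_gt0 ?divr_gt0 ?exprn_gt0 // ltr_wpDr.
  apply: le_trans (cond_num_le l_gt0 z1 aA A0 wJ T0 _) _ => [i|].
    rewrite mxE; set c := - _.
    apply: le_trans ((bounded_polyD bW (bounded_polyZ c bW')).2 i) _.
    rewrite mulrDl mul1r lerD2l normcN normcM normcV -/a ler_wpM2l //.
    rewrite ler_wpM2l ?(ltW H0) // lef_pV2 ?posrE ?exprn_gt0 //.
    apply: ler_weXn2l; first by rewrite ler1n -(ltr0n R).
    exact: ltnW.
  rewrite div1_exprz_sub ?gt_eqF // NL le_eqVlt; apply/orP; left; apply/eqP; ring.
have wJ := node_dual_row l_gt0 z1 a0 bW'.1 dW'.
have T0 : 0 < (normc (coef x j (l j).-1))^-1 * (H / N%:R ^+ (l j).+1).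
  by rewrite mulr_gt0 ?invr_gt0 ?divr_gt0 ?exprn_gt0.
apply: le_trans (cond_num_le l_gt0 z1 aA A0 wJ T0 _) _ => [i|].
  have := (bounded_polyZ (node x j / coef x j (l j).-1) bW').2 i.
  by rewrite mxE normcM normcV z1 mul1r.
rewrite div1_exprz_sub ?gt_eqF // NL le_eqVlt; apply/orP; left; apply/eqP; ring.
Qed.
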